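(* Let $M\ge2$ and let $C$ be the attractor of an affine iterated function system $f_i(x)=r_ix+a_i$, $1\le i\le M$, $0<r_i<1$, with strong separation, with $\operatorname{conv}(C)=[0,1]$, and with $f_i([0,1])=[a_i,b_i]$, $r_i=b_i-a_i$, where $$0=a_1<b_1<a_2<b_2<\cdots<a_M<b_M=1.$$ Set $g_{\min}:=\min_{2\le j\le M}(a_j-b_{j-1})$. Let $P=\{0=p_1<p_2<\cdots<p_k=1\}$ be a normalized $k$-point pattern ($k\ge2$), and write $\delta_{\min}=\min_{2\le j\le k}(p_j-p_{j-1})$ and $\delta_{\max}=\max_{2\le j\le k}(p_j-p_{j-1})$. Then $$G_P(C)\subseteq\bigcup_{n\ge0}\ \bigcup_{(i_1,\ldots,i_n)\in\{1,\ldots,M\}^n}(r_{i_1}\cdots r_{i_n})[L_P,U_P],$$ where $$L_P:=\frac{g_{\min}}{\delta_{\max}},$$ and $$U_P:=\min\left\{1,\ \frac{\sum_{i=1}^M r_i}{\delta_{\min}(k-M)},\ \frac{\max_{1\le i\le M}r_i}{\delta_{\min}(\lceil k/M\rceil-1)}\right\}\ \text{ if }k>M,\qquad U_P:=1\ \text{ if }2\le k\le M.$$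
   Context: The scale set of a pattern $P\subset[0,1]$ in a compact set $C\subset\mathbb R$ is $G_P(C):=\{s>0:\exists x\in\mathbb R\text{ with }x+sP\subset C\}$. The attractor of $\{f_i\}$ is the unique nonempty compact $C$ with $C=\bigcup_i f_i(C)$; strong separation means that the sets $f_i(C)$ are pairwise disjoint. For $n=0$ the empty product of contraction ratios equals $1$. $[L,U]$ is understood to be empty if $L>U$, and $c[L,U]=\{cs:s\in[L,U]\}$. *)

(* Defs.v *)
From HB Require Import structures.
From mathcomp Require Import all_boot all_order all_algebra.
From mathcomp Require Import all_classical all_reals all_analysis.
Import Order.TTheory GRing.Theory Num.Theory.
Import numFieldNormedType.Exports.

Set Implicit Arguments.
Unset Strict Implicit.
Unset Printing Implicit Defensive.

Local Open Scope classical_set_scope.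
Local Open Scope ring_scope.

Definition scale_set (R : realType) (P C : set R) : set R :=
  [set s | 0 < s /\ exists x : R, [set x + s * p | p in P] `<=` C].

(* For contractions there is exactly one such C (Hutchinson). *)
Definition is_attractor (R : realType) (I : finType) (f : I -> R -> R)
    (C : set R) : Prop :=
  [/\ C !=set0, compact C & C = \bigcup_(i : I) (f i @` C)].

Definition strong_separation (R : realType) (I : finType) (f : I -> R -> R)
    (C : set R) : Prop :=
  trivIset setT (fun i : I => f i @` C).

(* R^o is R seen as a module over itself, which [convex_set] asks for. *)
Definition convex_hull (R : realType) (A : set R) : set R :=
  smallest (@convex_set R R^o) A.

Definition affine_map (R : realType) (r a x : R) : R := r * x + a.

(* [\big[Num.min/x0]] also compares with its default x0; taking x0 among the
   values gives the true minimum of a nonempty finite family, and likewise for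
   the maximum. The value 0 on an empty family is a dummy. *)
Definition fin_min (R : realType) (I : finType) (D : pred I) (F : I -> R) : R :=
  if [pick i | D i] is Some i0 then \big[Num.min/F i0]_(i | D i) F i else 0.

Definition fin_max (R : realType) (I : finType) (D : pred I) (F : I -> R) : R :=
  if [pick i | D i] is Some i0 then \big[Num.max/F i0]_(i | D i) F i else 0.

Definition consecutive (n : nat) : pred ('I_n * 'I_n) :=
  fun ij => ij.2 == ij.1.+1 :> nat.

Definition gap_min (R : realType) (M : nat) (a b : 'I_M -> R) : R :=
  fin_min (@consecutive M) (fun ij => a ij.2 - b ij.1).

Definition delta_min (R : realType) (k : nat) (p : 'I_k -> R) : R :=
  fin_min (@consecutive k) (fun ij => p ij.2 - p ij.1).

Definition delta_max (R : realType) (k : nat) (p : 'I_k -> R) : R :=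
  fin_max (@consecutive k) (fun ij => p ij.2 - p ij.1).

Definition lower_scale (R : realType) (M k : nat) (a b : 'I_M -> R)
    (p : 'I_k -> R) : R :=
  gap_min a b / delta_max p.

Definition upper_scale (R : realType) (M k : nat) (r : 'I_M -> R)
    (p : 'I_k -> R) : R :=
  if (M < k)%N then
    Num.min 1
      (Num.min
        ((\sum_(i < M) r i) / (delta_min p * (k%:R - M%:R)))
        (fin_max predT r
           / (delta_min p * ((Num.ceil (k%:R / M%:R : R))%:~R - 1))))
  else 1.

(* Main.v *)
(* Given a copy x + sP inside C, pull it back by the f_i as long as it lies in a
   single f_i(C). Every pullback keeps the scale at most 1 but divides it by some
   r_i < 1, so the process stops at a copy x' + s'P in C, with s = r_w s', that
   meets two first-level intervals. Some gap then separates two consecutive points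
   of that copy, whence s' >= L_P, and counting the points in each first-level
   interval yields s' <= U_P. *)
Require Import Defs.
From mathcomp Require Import all_boot all_order all_algebra.
From mathcomp Require Import all_classical all_reals all_analysis.
From mathcomp Require Import ring lra.
Import Order.TTheory GRing.Theory Num.Theory.
Import numFieldNormedType.Exports.

Set Implicit Arguments.
Unset Strict Implicit.
Unset Printing Implicit Defensive.

Local Open Scope classical_set_scope.
Local Open Scope ring_scope.

Lemma fin_min_le (R : realType) (I : finType) (D : pred I) (F : I -> R) i :
  D i -> fin_min D F <= F i.
Proof.
by rewrite /fin_min => Di; case: pickP => [j Dj|/(_ i)]; rewrite ?Di //;
  exact: bigmin_le_cond.
Qed.

Lemma le_fin_max (R : realType) (I : finType) (D : pred I) (F : I -> R) i :
  D i -> F i <= fin_max D F.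
Proof.
by rewrite /fin_max => Di; case: pickP => [j Dj|/(_ i)]; rewrite ?Di //;
  exact: le_bigmax_cond.
Qed.

Lemma fin_min_gt (R : realType) (I : finType) (D : pred I) (F : I -> R) x i :
  D i -> (forall j, D j -> x < F j) -> x < fin_min D F.
Proof.
move=> Di xF; rewrite /fin_min; case: pickP => [j Dj|/(_ i)]; last by rewrite Di.
by apply/bigmin_gtP; split=> [|l Dl]; apply: xF.
Qed.

Lemma fin_max_lt (R : realType) (I : finType) (D : pred I) (F : I -> R) x i :
  D i -> (forall j, D j -> F j < x) -> fin_max D F < x.
Proof.
move=> Di Fx; rewrite /fin_max; case: pickP => [j Dj|/(_ i)]; last by rewrite Di.
by apply/bigmax_ltP; split=> [|l Dl]; apply: Fx.
Qed.

(** Telescoping over consecutive indices. The case [d = 0] is monotonicity. *)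
Lemma increments_le (R : realType) (n : nat) (u : 'I_n -> R) (d : R) :
    (forall i j : 'I_n, j = i.+1 :> nat -> d <= u j - u i) ->
  forall i j : 'I_n, (i <= j)%N -> (j - i)%:R * d <= u j - u i.
Proof.
move=> hd i [j ltj] /=; elim: j ltj => [|j IH] ltj leij.
  have -> : i = Ordinal ltj by apply/val_inj => /=; case: (nat_of_ord i) leij.
  by rewrite subn0 mul0r subrr.
case: (ltngtP i j.+1) leij => [ltij _||eqij _] //; last first.
  have -> : i = Ordinal ltj by exact/val_inj.
  by rewrite /= subnn mul0r subrr.
have := hd (Ordinal (ltnW ltj)) (Ordinal ltj) erefl.
have := IH (ltnW ltj) ltij.
by rewrite subSn // -natr1 mulrDl mul1r; lra.
Qed.

(** If [i] and [j] are the extreme indices of [S], then [u j - u i] is at least [(j - i) * d], and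
    [S] has at most [j - i + 1] elements. For empty [S] the left side is [- d], whence the sign
    conditions. *)
Lemma card_separated_le (R : realType) (n : nat) (u : 'I_n -> R) (d D : R)
    (S : {pred 'I_n}) :
    0 <= d -> 0 <= D ->
    (forall i j : 'I_n, j = i.+1 :> nat -> d <= u j - u i) ->
    (forall i j : 'I_n, i \in S -> j \in S -> u j - u i <= D) ->
  (#|S|%:R - 1) * d <= D.
Proof.
move=> d0 D0 hd hD; have [i0 Si0|/eq_card0->] := pickP (mem S); last by lra.
case: (@arg_minnP _ i0 (mem S) val Si0) => i Si mini.
case: (@arg_maxnP _ i0 (mem S) val Si0) => j Sj maxj.
have leij : (i <= j)%N := mini _ Sj.
apply: (le_trans _ (hD _ _ Si Sj)); apply: le_trans (increments_le hd leij).
(* The values of [S] form a duplicate-free list inside the [j - i + 1] integers from [i] to [j]. *)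
rewrite ler_wpM2r // lerBlDr natr1 ler_nat cardE -(size_map val).
rewrite -[X in (_ <= X)%N](size_iota i); apply: uniq_leq_size.
  by rewrite (map_inj_uniq val_inj) enum_uniq.
move=> _ /mapP[l + ->]; rewrite mem_enum => Sl.
rewrite mem_iota -subSn // subnKC ?(leqW leij) // ltnS.
by apply/andP; split; [exact: mini|exact: maxj].
Qed.

Lemma sum_card_fibres (T I : finType) (l : T -> I) :
  (\sum_i #|[pred j | l j == i]| = #|T|)%N.
Proof.
rewrite -sum1_card (partition_big l predT) //=; apply: eq_bigr => i _.
by rewrite -sum1_card; apply: eq_bigl => j; rewrite inE.
Qed.

(** Otherwise summing over all fibres gives [#|I| * #|T| <= #|I| * (#|T| - 1)]. The product form
    postpones the rounding to a ceiling. *)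
Lemma pigeonhole_fibre (T I : finType) (l : T -> I) :
  (0 < #|I|)%N -> exists i, (#|T| <= #|I| * #|[pred j | l j == i]|)%N.
Proof.
move=> I0; apply: contrapT => /forallNP small.
have T0 : (0 < #|T|)%N.
  by case/card_gt0P: I0 => i _; case: #|T| (small i).
have : (\sum_(i : I) #|I| * #|[pred j | l j == i]| <= \sum_(i : I) #|T|.-1)%N.
  by apply: leq_sum => i _; rewrite -ltnS prednK // ltnNge; exact/negP/small.
by rewrite -big_distrr /= sum_card_fibres sum_nat_const leq_pmul2l // -ltnS prednK // ltnn.
Qed.

(* [l j] is the index of the first-level interval holding the [j]-th point. The
   points in one interval are s * delta_min-separated, so each fibre of [l] has
   (#|fibre| - 1) * s * delta_min <= r i: summing over i gives the second term of
   the minimum, and the largest fibre gives the third. *)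
Lemma le_upper_scale (R : realType) (M k : nat) (r : 'I_M -> R) (p : 'I_k -> R)
    (l : 'I_k -> 'I_M) (s : R) :
    (0 < M)%N -> (2 <= k)%N -> 0 < s <= 1 -> (forall i, 0 <= r i) ->
    (forall i j : 'I_k, j = i.+1 :> nat -> p i < p j) ->
    (forall i j : 'I_k, l i = l j -> s * (p j - p i) <= r (l i)) ->
  s <= upper_scale r p.
Proof.
move=> M0 k2 /andP[s0 s1] r0 pinc hl; rewrite /upper_scale.
case: ltnP => // ltMk.
have d0 : 0 < delta_min p.
  apply: (@fin_min_gt _ _ _ _ _ (Ordinal (ltnW k2), Ordinal k2)) => //=.
  by move=> [i j] /eqP /= /pinc; rewrite subr_gt0.
have fib i : (#|[pred j | l j == i]|%:R - 1) * (s * delta_min p) <= r i.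
  apply: (@card_separated_le _ _ (fun j => s * p j)) => //.
  - by rewrite mulr_ge0 ?ltW.
  - move=> x y yx; rewrite -mulrBr ler_wpM2l ?(ltW s0) //.
    apply: (@fin_min_le _ _ _ (fun ij => p ij.2 - p ij.1) (x, y)).
    by rewrite /consecutive /= yx.
  - move=> x y; rewrite !inE => /eqP lx /eqP ly.
    by rewrite -mulrBr -lx; apply: hl; rewrite lx.
rewrite !le_min s1 /=; apply/andP; split.
  rewrite ler_pdivlMr; last by rewrite mulr_gt0 // subr_gt0 ltr_nat.
  rewrite mulrA [X in X <= _]mulrC.
  (* Empty fibres count as well, with the term -1, so the sum is exactly [k - M]. *)
  have -> : k%:R - M%:R = \sum_(i < M) (#|[pred j | l j == i]|%:R - 1) :> R.
    rewrite big_split /= -natr_sum sum_card_fibres card_ord.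
    by rewrite sumrN sumr_const card_ord.
  by rewrite mulr_suml; apply: ler_sum => i _; apply: fib.
have MR : 0 < M%:R :> R by rewrite ltr0n.
have [|i] := @pigeonhole_fibre _ _ l; rewrite !card_ord // => ki.
have ceil_gt1 : 0 < (Num.ceil (k%:R / M%:R : R))%:~R - 1 :> R.
  rewrite subr_gt0; apply: lt_le_trans (ceil_ge _).
  by rewrite ltr_pdivlMr // mul1r ltr_nat.
rewrite ler_pdivlMr ?mulr_gt0 // mulrA [X in X <= _]mulrC.
apply: (le_trans _ (@le_fin_max _ _ predT r i isT)); apply: le_trans (fib i).
(* The size of the fibre is an integer that is at least [k / M], hence at least the ceiling. *)
rewrite ler_wpM2r ?mulr_ge0 ?(ltW s0) ?(ltW d0) // lerD2r -[leRHS]mulrz_nat ler_int.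
by rewrite ceil_le_int mulrz_nat ler_pdivrMr // -natrM ler_nat mulnC.
Qed.

(* Two consecutive points of the copy lie in different intervals, hence on
   opposite sides of a gap. *)
Lemma lower_scale_le (R : realType) (M k : nat) (a b : 'I_M -> R)
    (p : 'I_k -> R) (l : 'I_k -> 'I_M) (x s : R) :
    (2 <= k)%N -> 0 < s ->
    (forall i, a i < b i) ->
    (forall i j : 'I_M, j = i.+1 :> nat -> b i < a j) ->
    (forall i j : 'I_k, j = i.+1 :> nat -> p i < p j) ->
    (forall j, a (l j) <= x + s * p j <= b (l j)) ->
    (exists i j, l i != l j) ->
  lower_scale a b p <= s.
Proof.
move=> k2 s0 hab hba pinc hl hne.
have amono (i j : 'I_M) : (i <= j)%N -> a i <= a j.
  move=> leij; rewrite -subr_ge0 -(mulr0 (j - i)%:R).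
  apply: (increments_le _ leij) => x' y' /hba; move: (hab x'); lra.
have gap (i j : 'I_M) : (i < j)%N -> gap_min a b <= a j - b i.
  move=> ltij; have lti := leq_ltn_trans ltij (ltn_ord j).
  have := amono (Ordinal lti) j ltij.
  have : gap_min a b <= a (Ordinal lti) - b i.
    apply: (@fin_min_le _ _ _ (fun ij => a ij.2 - b ij.1) (i, Ordinal lti)).
    exact: eqxx.
  lra.
have dmax (i j : 'I_k) : j = i.+1 :> nat -> p j - p i <= delta_max p.
  move=> ji; apply: (@le_fin_max _ _ _ (fun ij => p ij.2 - p ij.1) (i, j)).
  by rewrite /consecutive /= ji.
have dmax0 : 0 < delta_max p.
  have := dmax (Ordinal (ltnW k2)) (Ordinal k2) erefl.
  by have := pinc (Ordinal (ltnW k2)) (Ordinal k2) erefl; lra.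
(* If consecutive points always shared a label, [l] would be constant by induction from index 0. *)
have [i [j [ji lij]]] : exists i j : 'I_k, j = i.+1 :> nat /\ l i != l j.
  apply: contrapT => hcst; case: hne => i [j]; apply/negP/negPn.
  suff cst (h : 'I_k) : l h = l (Ordinal (ltnW k2)) by rewrite !cst.
  case: h; elim=> [|h IH] lth; first by congr l; exact: val_inj.
  rewrite -(IH (ltnW lth)); apply/eqP/negPn/negP => hh; apply: hcst.
  by exists (Ordinal (ltnW lth)), (Ordinal lth); rewrite eq_sym.
rewrite /lower_scale ler_pdivrMr //.
apply: le_trans (_ : s * (p j - p i) <= _); last first.
  by rewrite ler_wpM2l ?(ltW s0) ?dmax.
have sp : s * p i < s * p j by rewrite ltr_pM2l // pinc.
case/andP: (hl i) => ai bi; case/andP: (hl j) => aj bj; rewrite mulrBr.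
case: (ltngtP (l i) (l j)) => [lt|lt|eq].
- by have := gap _ _ lt; lra.
(* Impossible order: the interval of the later point would end before that of the earlier one
   starts. *)
- have lti := leq_ltn_trans lt (ltn_ord (l i)).
  have := amono (Ordinal lti) (l i) lt.
  by have := hba (l j) (Ordinal lti) erefl; lra.
- by move/negP: lij; case; apply/eqP/val_inj.
Qed.

Lemma exists_expr_lt (R : realType) (z s : R) :
  0 <= z < 1 -> 0 < s -> exists n, z ^+ n < s.
Proof.
move=> /andP[z0 z1] s0; have zn : `|z| < 1 by rewrite ger0_norm.
have /cvgrPdist_lt/(_ s s0)[n _ /(_ n (leqnn n))] := cvg_expr zn.
by rewrite /= sub0r normrN ger0_norm ?exprn_ge0 // => lts; exists n.
Qed.

Theorem theorem3p1 (R : realType) (M k : nat) (r a b : 'I_M -> R)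
    (C : set R) (p : 'I_k -> R)
    (hM : (2 <= M)%N) (hk : (2 <= k)%N)
    (hr : forall i, 0 < r i < 1)
    (hC : is_attractor (fun i => affine_map (r i) (a i)) C)
    (hsep : strong_separation (fun i => affine_map (r i) (a i)) C)
    (hconv : convex_hull C = `[0, 1]%classic)
    (himg : forall i, affine_map (r i) (a i) @` `[0, 1]%classic = `[a i, b i]%classic)
    (hrab : forall i, r i = b i - a i)
    (ha1 : forall i : 'I_M, i = 0%N :> nat -> a i = 0)
    (hab : forall i, a i < b i)
    (hba : forall i j : 'I_M, j = i.+1 :> nat -> b i < a j)
    (hbM : forall i : 'I_M, i.+1 = M -> b i = 1)
    (hp1 : forall i : 'I_k, i = 0%N :> nat -> p i = 0)
    (hpinc : forall i j : 'I_k, j = i.+1 :> nat -> p i < p j)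
    (hpk : forall i : 'I_k, i.+1 = k -> p i = 1) :
  scale_set (range p) C `<=`
    \bigcup_(n : nat) \bigcup_(w : n.-tuple 'I_M)
      [set (\prod_(i <- w) r i) * s
        | s in `[lower_scale a b p, upper_scale r p]%classic].
Proof.
have [_ _ CE] := hC.
have C01 y : C y -> 0 <= y <= 1.
  have : C `<=` convex_hull C by exact: sub_gen_smallest.
  by rewrite hconv => /[apply]; rewrite /= in_itv.
have k0 := ltnW hk.
have klast : (k.-1 < k)%N by rewrite prednK.
(* The pattern contains 0 and 1, so [x] and [x + s] both lie in [[0, 1]]. *)
have le1 s x : (forall j, C (x + s * p j)) -> s <= 1.
  move=> xsC; have /C01 := xsC (Ordinal k0); have /C01 := xsC (Ordinal klast).
  by rewrite (hp1 (Ordinal k0)) // (hpk (Ordinal klast)) /= ?prednK //; lra.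
have rho1 : 0 <= fin_max predT r < 1.
  have i0 : 'I_M := Ordinal (ltnW hM).
  rewrite (@fin_max_lt _ _ _ _ _ i0) // => [|j _]; last by case/andP: (hr j).
  by rewrite andbT (le_trans _ (@le_fin_max _ _ predT r i0 isT)) // ltW //;
    case/andP: (hr i0).
(* Since scales are at most 1, [fin_max predT r ^+ n < s] allows at most n pullbacks. *)
suff zoom n s x : fin_max predT r ^+ n < s -> 0 < s ->
    (forall j, C (x + s * p j)) ->
    exists w : seq 'I_M, exists2 t,
      lower_scale a b p <= t <= upper_scale r p & s = (\prod_(i <- w) r i) * t.
  move=> s [s0 [x xsC]].
  have [n ltn] := exists_expr_lt rho1 s0.
  have [|w [t tLU sE]] := zoom n s x ltn s0.
    by move=> j; apply: xsC; exists (p j) => //; exists j.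
  by exists (size w) => //; exists (in_tuple w) => //; exists t.
(* For [n = 0] the hypothesis reads [1 < s], against [s <= 1]. *)
elim: n s x => [|n IH] s x ltns s0 xsC; have s1 := le1 _ _ xsC.
  by move: ltns; rewrite expr0; lra.
have /choice[l /choice[y ly]] : forall j, exists i, exists y,
    C y /\ affine_map (r i) (a i) y = x + s * p j.
  by move=> j; have := xsC j; rewrite {1}CE => -[i _ [y Cy yE]]; exists i, y.
have inl j : a (l j) <= x + s * p j <= b (l j).
  have [/C01/andP[y0 y1] <-] := ly j; rewrite /affine_map hrab.
  by have := hab (l j); nra.
have [[i [j lij]]|lcst] := pselect (exists i j, l i != l j).
  (* The copy meets two first-level intervals: stop with the empty word. *)
  exists [::], s; last by rewrite big_nil mul1r.
  apply/andP; split.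
    by apply: (lower_scale_le hk s0 hab hba hpinc inl); exists i, j.
  apply: (@le_upper_scale _ _ _ _ _ l) => //.
  - exact: ltnW.
  - by rewrite s0.
  - by move=> h; case/andP: (hr h) => /ltW.
  - move=> g h lgh; have := inl g; have := inl h; rewrite -lgh hrab; lra.
pose i := l (Ordinal k0); have li j : l j = i.
  by apply/eqP/negPn/negP => lj; apply: lcst; exists j, (Ordinal k0).
have /andP[ri0 ri1] := hr i.
(* The whole copy lies in one piece; its preimage under that map has scale [s / r i], which exceeds
   the [n]-th power of the largest ratio since [r i] is at most that ratio. *)
have [|||w [t tLU sE]] := IH (s / r i) ((x - a i) / r i).
- rewrite ltr_pdivlMr //; apply: le_lt_trans ltns; rewrite exprSr.
  by rewrite ler_wpM2l ?exprn_ge0 ?le_fin_max //; case/andP: rho1.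
- by rewrite divr_gt0.
- move=> j; have [Cy yE] := ly j; move: yE; rewrite li /affine_map => yE.
  suff -> : (x - a i) / r i + s / r i * p j = y j by [].
  have -> : y j = (x + s * p j - a i) / r i by rewrite -yE addrK mulrC mulKf ?lt0r_neq0.
  by field; rewrite lt0r_neq0.
exists (i :: w), t => //; rewrite big_cons -mulrA -sE mulrC divfK //.
exact: lt0r_neq0.
Qed.
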